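(* Let $T$ be a tree on $n$ vertices and let $\mathcal P$ be a set of $n-1$ paths in $T$. Then $|\det(A(\mathcal P,T))|\leq 2^{n-1}$.
   Context: The path-edge incidence matrix $A(\mathcal P,T)\in\{0,1\}^{\mathcal P\times E(T)}$ has rows indexed by the paths in $\mathcal P$ and columns indexed by the edges of $T$, with $A(\mathcal P,T)_{Q,e}=1$ if $e\in E(Q)$ and $0$ otherwise. Since $|\mathcal P|=|E(T)|=n-1$ it is square, and the absolute value of its determinant does not depend on the orderings of rows and columns. *)

(* Defs.v *)
From mathcomp Require Import all_boot all_order all_algebra.
Set Implicit Arguments.
Unset Strict Implicit.
Unset Printing Implicit Defensive.

Record sgraph := SGraph {
  vertex :> finType;
  adj : rel vertex;
  adj_sym : symmetric adj;
  adj_irrefl : irreflexive adj }.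

Definition edges (G : sgraph) : {set {set G}} :=
  [set [set u.1; u.2] | u : G * G & adj u.1 u.2].

Definition connected (G : sgraph) : Prop :=
  0 < #|G| /\ forall x y : G, connect (@adj G) x y.

Definition acyclic (G : sgraph) : Prop :=
  forall c : seq G, 2 < size c -> uniq c -> ~~ cycle (@adj G) c.

Definition is_tree (G : sgraph) : Prop := connected G /\ acyclic G.

(* A subgraph is the pair of its vertex set and its edge set, so that a path
   and its reversal are the same object. *)
Definition subgraph (G : sgraph) : finType := ({set G} * {set {set G}})%type.

Definition walk_subgraph (G : sgraph) (x : G) (p : seq G) : subgraph G :=
  ([set v in x :: p], [set [set u.1; u.2] | u in zip (x :: p) p]).

(* The one-vertex path (p = [::]) is allowed. *)
Definition is_path (G : sgraph) (Q : subgraph G) : Prop :=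
  exists (x : G) (p : seq G),
    [/\ path (@adj G) x p, uniq (x :: p) & Q = walk_subgraph x p].

(* The matrix A(P, T) for the ordering [rows] of the set of paths P and the
   ordering [cols] of the edge set of T. *)
Definition path_edge_incidence (G : sgraph) (m k : nat)
    (rows : m.-tuple (subgraph G)) (cols : k.-tuple {set G}) : 'M[int]_(m, k) :=
  (\matrix_(i, j) (tnth cols j \in (tnth rows i).2)%:R)%R.

(* This is what makes A(P, T) square when #|P| = n.-1. *)
Lemma tree_card_edges (G : sgraph) : is_tree G -> #|edges G| = #|G|.-1.
Proof.
case=> -[/card_gt0P[r _] conn] acyc.
have dex v : exists n, [exists t : n.-tuple G,
    path (@adj G) r t && (last r t == v)].
  have /connectP[p pp ->] := conn r v.
  by exists (size p); apply/existsP; exists (in_tuple p); rewrite pp eqxx.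
pose d v := ex_minn (dex v).
have dle p : path (@adj G) r p -> d (last r p) <= size p.
  move=> pp; rewrite /d; case: ex_minnP => m _; apply.
  by apply/existsP; exists (in_tuple p); rewrite pp eqxx.
have parex v : v != r -> exists u, adj u v && (d u < d v).
  move=> vr; rewrite {2}/d; case: ex_minnP => m /existsP[[t /= /eqP st]].
  case/andP=> pt /eqP lt _.
  case/lastP: t st pt lt => [|t w] st pt lt; first by rewrite -lt eqxx in vr.
  move: pt lt st; rewrite rcons_path last_rcons size_rcons => /andP[pt aw] wv <-.
  by exists (last r t); rewrite -wv aw /= ltnS dle.
pose par v := odflt r [pick u | adj u v && (d u < d v)].
have parP v : v != r -> adj (par v) v && (d (par v) < d v).
  move=> /parex[u hu]; rewrite /par; case: pickP => [//|/(_ u)].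
  by rewrite hu.
pose f v : {set G} := [set par v; v].
have finj : {in [set~ r] &, injective f}.
  move=> v w; rewrite !inE => /parP/andP[_ dv] /parP/andP[_ dw] fe.
  apply/eqP; apply: contraT => vw.
  have : v \in f w by rewrite -fe !inE eqxx orbT.
  have : w \in f v by rewrite fe !inE eqxx orbT.
  rewrite !inE (negbTE vw) [w == v]eq_sym (negbTE vw) !orbF => /eqP wv /eqP vw'.
  by have := ltnW dw; rewrite -vw' leqNgt {1}wv dv.
suff <- : f @: [set~ r] = edges G by rewrite card_in_imset // cardsC1.
apply/eqP; rewrite eqEsubset; apply/andP; split.
  apply/subsetP=> _ /imsetP[v + ->]; rewrite !inE => /parP/andP[a _].
  by apply/imsetP; exists (par v, v); rewrite ?inE.
apply/subsetP=> _ /imsetP[[x y] /= + ->]; rewrite inE /= => axy.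
pose g : rel G := fun a b => [set a; b] \in f @: [set~ r].
have gsym : symmetric g by move=> a b; rewrite /g setUC.
have csym : connect_sym g by apply: sym_connect_sym.
have gadj : subrel g (@adj G).
  move=> a b /imsetP[v]; rewrite !inE => /parP/andP[av _] fe.
  have ha : a \in f v by rewrite -fe !inE eqxx.
  have hb : b \in f v by rewrite -fe !inE eqxx orbT.
  have hp : par v \in [set a; b] by rewrite fe !inE eqxx.
  have hv : v \in [set a; b] by rewrite fe !inE eqxx orbT.
  have ne : par v != v.
    by apply: contraTneq av => ->; rewrite adj_irrefl.
  move: ha hb hp hv; rewrite !inE.
  case/orP=> /eqP -> /orP[] /eqP ->; rewrite ?orbb //.
  - by move=> _; rewrite eq_sym (negbTE ne).
  - by rewrite adj_sym.
  - by rewrite (negbTE ne).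
have gr v : connect g v r.
  have [k] := ubnP (d v); elim: k v => // k IH v; rewrite ltnS => dk.
  have [->|vr] := eqVneq v r; first exact: connect0.
  have /andP[_ dv] := parP v vr.
  apply: connect_trans (IH (par v) (leq_trans dv dk)).
  by apply: connect1; rewrite gsym; apply: imset_f; rewrite !inE.
have : connect g x y by rewrite (connect_trans (gr x)) // csym.
case/connectP=> p0 /shortenP[p pp up _] ly.
case: p pp up ly => [|z [|w p]] pp up ly.
- by move: axy; rewrite ly adj_irrefl.
- by move: pp; rewrite /= andbT ly.
- have := acyc [:: x, z, w & p] isT up.
  suff -> : cycle (@adj G) [:: x, z, w & p] by [].
  by rewrite (cycle_path x) [last _ _]/= -[last w p]/(last x [:: z, w & p]) -ly
    /= -[X in _ && X]/(path (@adj G) x [:: z, w & p]) (sub_path gadj pp)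
    adj_sym axy.
Qed.

(* Main.v *)
(** Root the tree and let [par] be the parent map; every edge is {par v, v} for a
    unique non-root vertex v.  A path climbs from one end to its highest vertex
    and then descends to the other end, so its incidence vector is the sum of
    those of two vertical paths.  By multilinearity the determinant is a sum of
    2^(n-1) determinants of matrices of vertical paths.  Multiplying the row of
    a vertical path from x up to a by the (unimodular) oriented incidence matrix
    of the tree with the root deleted telescopes it to e_x - e_a, and a square
    matrix with such rows has determinant -1, 0 or 1. *)

Require Import Defs.
From mathcomp Require Import all_boot all_order all_algebra.
From mathcomp Require Import zify.

Set Implicit Arguments.
Unset Strict Implicit.
Unset Printing Implicit Defensive.
Import Order.TTheory GRing.Theory Num.Theory.
Local Open Scope ring_scope.

(** * Determinants *)

(* [None] stands for a deleted column, so that a row may have fewer than two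
   nonzero entries. *)
Lemma normr_det_row_differences (m : nat) (A : 'M[int]_m)
    (x y : 'I_m -> option 'I_m) :
  (forall i k, A i k = (x i == Some k)%:R - (y i == Some k)%:R) ->
  `|\det A| <= 1.
Proof.
elim: m A x y => [|m IH] A x y hA; first by rewrite det_mx00 normr1.
(* Deleting column [k] turns an entry at [k] into [None] through [unlift k], so minors have rows of
   the same form. *)
have minor i k : `|cofactor A i k| <= 1.
  rewrite /cofactor normrM normr_sign mul1r.
  apply: (IH _ (fun i' => obind (unlift k) (x (lift i i')))
               (fun i' => obind (unlift k) (y (lift i i')))) => i' k'.
  have unl (o : option 'I_m.+1) :
      (o == Some (lift k k')) = (obind (unlift k) o == Some k').
    case: o => [u|] //=; case: unliftP => [u' ->|->].
      by rewrite /eq_op /= (inj_eq lift_inj).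
    by rewrite /eq_op /= (negbTE (neq_lift _ _)).
  by rewrite !mxE hA !unl.
(* Expanding along a row with at most one nonzero entry, itself a sign, leaves one signed cofactor
   or 0. *)
have sparse i (s : int) (o : option 'I_m.+1) : `|s| = 1 ->
    (forall k, A i k = s * (o == Some k)%:R) -> `|\det A| <= 1.
  move=> s1 hs; rewrite (expand_det_row A i).
  case: o hs => [k|] hs.
    rewrite (bigD1 k) //= big1 ?addr0 => [|j jk].
      by rewrite hs eqxx mulr1 normrM s1 mul1r.
    by rewrite hs /eq_op /= eq_sym (negbTE jk) mulr0 mul0r.
  by rewrite big1 ?normr0 // => j _; rewrite hs mulr0 mul0r.
have [/existsP[i /eqP xi]|/existsPn xS] := boolP [exists i, x i == None].
  by apply: (sparse i (-1) (y i)) => [|k] //; rewrite hA xi sub0r mulN1r.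
have [/existsP[i /eqP yi]|/existsPn yS] := boolP [exists i, y i == None].
  by apply: (sparse i 1 (x i)) => [|k] //; rewrite hA yi subr0 mul1r.
(* No entry is [None] now, so every row sums to 0; applying the adjugate to the all-ones vector in
   the kernel gives [\det A = 0]. *)
suff -> : \det A = 0 by rewrite normr0.
have sum1 (o : option 'I_m.+1) : o != None ->
    \sum_k (o == Some k)%:R = 1 :> int.
  case: o => // u _; rewrite (bigD1 u) //= eqxx big1 ?addr0 // => k ku.
  by rewrite /eq_op /= eq_sym (negbTE ku).
have A1 : A *m (const_mx 1 : 'cV_m.+1) = 0.
  apply/matrixP=> i j; rewrite !mxE.
  under eq_bigr => k _ do rewrite mxE mulr1 hA.
  by rewrite sumrB !sum1 // subrr.
have := congr1 (mulmx (\adj A)) A1.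
rewrite mulmxA mul_adj_mx mulmx0 mul_scalar_mx => /matrixP/(_ ord0 ord0).
by rewrite !mxE mulr1.
Qed.

(** Multilinearity in the rows: in each Leibniz term the product of sums expands over the choice
    functions [g]. *)
Lemma det_row_sum (R : comNzRingType) (I : finType) (m : nat)
    (F : 'I_m -> I -> 'I_m -> R) :
  \det (\matrix_(i, k) \sum_b F i b k) =
  \sum_(g : {ffun 'I_m -> I}) \det (\matrix_(i, k) F i (g i) k).
Proof.
rewrite /determinant exchange_big /=; apply: eq_bigr => s _.
rewrite -mulr_sumr; congr (_ * _).
under eq_bigr => i _ do rewrite mxE.
rewrite bigA_distr_bigA /=; apply: eq_bigr => g _.
by apply: eq_bigr => i _; rewrite mxE.
Qed.

Lemma telescope_traject (T : eqType) (R : zmodType) (g : T -> R) (f : T -> T)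
    (x : T) (m : nat) :
  \sum_(u <- traject f x m) (g u - g (f u)) = g x - g (iter m f x).
Proof.
elim: m x => [|m IH] x; first by rewrite big_nil subrr.
by rewrite trajectS big_cons IH -iterSr addrA subrK.
Qed.

(** * Vertical paths in a rooted tree *)

Section RootedTree.
Variables (T : sgraph) (r : T) (par : T -> T).

Definition parent_edge (v : T) : {set T} := [set par v; v].

(** [traject] omits its end point, so the last clause says that the climb from [v] first meets [r]
    after [m] steps; [par r] is unconstrained. *)
Definition rooting : Prop :=
  [/\ {in [set~ r] &, injective parent_edge},
      parent_edge @: [set~ r] = edges T
    & forall v, exists m, iter m par v = r /\ r \notin traject par v m].

Hypothesis rootT : rooting.

Lemma adj_parent x y : adj x y ->
  (x != r /\ y = par x) \/ (y != r /\ x = par y).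
Proof.
case: rootT => _ pE _ axy.
have : [set x; y] \in edges T by apply/imsetP; exists (x, y); rewrite ?inE.
rewrite -pE => /imsetP[v]; rewrite !inE => vr fe.
have ne : x != y by apply: contraTneq axy => ->; rewrite adj_irrefl.
have /setP ext := fe.
have := ext x; have := ext y; rewrite !inE !eqxx orbT /= => /esym hy /esym hx.
case/orP: hx => /eqP hx; case/orP: hy => /eqP hy; subst.
- by rewrite eqxx in ne.
- by right.
- by left.
- by rewrite eqxx in ne.
Qed.

Lemma walk_edge_vertices (x : T) (p : seq T) (e : {set T}) (v : T) :
  e \in (walk_subgraph x p).2 -> v \in e -> v \in x :: p.
Proof.
case/imsetP=> -[a b] /= hab -> vab.
suff /andP[ha hb] : (a \in x :: p) && (b \in x :: p).
  by case/set2P: vab => ->.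
elim: p x hab {vab} => [|z p IH] x //=; rewrite inE.
case/predU1P => [[-> ->]|/IH /andP[ha hb]]; first by rewrite !inE !eqxx orbT.
by rewrite !(in_cons x) ha hb !orbT.
Qed.

(* [m1] and [m2] are the numbers of edges on the two sides of the highest vertex. *)
Lemma path_two_vertical (x : T) (p : seq T) :
  path (@adj T) x p -> uniq (x :: p) ->
  exists m1 m2 : nat,
    let s := (traject par x m1 ++ traject par (last x p) m2)%SEQ in
    [/\ iter m1 par x = iter m2 par (last x p), r \notin s
      & {in [set~ r], forall v,
          ((parent_edge v \in (walk_subgraph x p).2) : nat) = count_mem v s}].
Proof.
have [finj _ _] := rootT.
elim: p x => [|z p IH] x.
  move=> _ _; exists 0%N, 0%N; split=> // v _ /=.
  by apply/eqP; rewrite eqb0; apply/imsetP=> -[].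
rewrite /= => /andP[axz pz] /andP[xzp uzp].
have [m1 [m2 [meet rs cnt]]] := IH z pz uzp.
have rest (e : {set T}) : x \in e -> e \notin (walk_subgraph z p).2.
  by move=> xe; apply: contra xzp => /walk_edge_vertices/(_ xe).
have step e : (e \in (walk_subgraph x (z :: p)).2) =
    (e == [set x; z]) || (e \in (walk_subgraph z p).2).
  apply/imsetP/orP => [[u]|].
    rewrite /= inE => /predU1P[->|up] ->; first by left.
    by right; apply/imsetP; exists u.
  case=> [/eqP ->|/imsetP[u up ->]]; first by exists (x, z); rewrite //= inE eqxx.
  by exists u; rewrite //= inE up orbT.
have split_count v w : v != r -> w != r -> [set x; z] = parent_edge w ->
    ((parent_edge v \in (walk_subgraph x (z :: p)).2) : nat) =
    ((w == v) + (parent_edge v \in (walk_subgraph z p).2))%N.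
  move=> vr wr ew; rewrite step ew (inj_in_eq finj) ?inE // eq_sym.
  case: eqP => //= <-; rewrite -ew (negbTE (rest _ _)) //.
  by rewrite !inE eqxx.
(* If [z] is the parent of [x], the climb from the first end gains one step. *)
case: (adj_parent axz) => -[wr hpar].
  exists m1.+1, m2; split.
  - by rewrite iterSr -hpar.
  - by rewrite trajectS /= inE negb_or eq_sym wr -hpar.
  move=> v; rewrite !inE => vr; rewrite (split_count v x) //.
    by rewrite trajectS /= -hpar cnt ?inE.
  by rewrite /parent_edge -hpar setUC.
have ez : [set x; z] = parent_edge z by rewrite /parent_edge -hpar.
(* Here [x] is the parent of [z]. If [m1 = 0], then [z] was the highest vertex and the climb from
   the other end gains the step to [x]. *)
case: m1 meet rs cnt => [|m1] meet rs cnt.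
  exists 0%N, m2.+1; split.
  - by rewrite /= -[RHS]/(par (iter m2 par (last z p))) -meet.
  - by rewrite trajectSr /= mem_rcons inE negb_or eq_sym -meet wr.
  move=> v; rewrite !inE => vr; rewrite (split_count v z) // cnt ?inE //.
  by rewrite trajectSr /= -meet -cats1 count_cat /= addn0 addnC.
(* A positive [m1] would put the edge between [z] and [x] in the rest of the walk, which avoids
   [x]. *)
have := cnt z; rewrite !inE wr => /(_ isT).
by rewrite -ez (negbTE (rest _ _)) ?trajectS /= ?eqxx // !inE eqxx.
Qed.

(** * Oriented incidence matrix and the determinant bound *)

Variables (m : nat) (ch : 'I_m -> T).
Hypotheses (ch_inj : injective ch) (ch_codom : forall v, v != r -> exists j, ch j = v)
  (ch_nonroot : forall j, ch j != r).

(** Each edge is labelled by its lower end [ch j], so edges and non-root vertices share one index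
    set; an edge at the root keeps only its entry 1. *)
Definition oriented_incidence : 'M[int]_m :=
  \matrix_(j, k) ((ch j == ch k)%:R - (par (ch j) == ch k)%:R).

Definition vertical_row (x : T) (l : nat) (j : 'I_m) : int :=
  (count_mem (ch j) (traject par x l))%:R.

Lemma vertical_row_telescope (x : T) (l : nat) (k : 'I_m) :
  r \notin traject par x l ->
  \sum_j vertical_row x l j * oriented_incidence j k =
  (x == ch k)%:R - (iter l par x == ch k)%:R.
Proof.
move=> rx; rewrite -(telescope_traject (fun u => (u == ch k)%:R : int)).
rewrite /vertical_row; elim: (traject par x l) rx => [|u s IH].
  by rewrite big_nil => _; rewrite big1 // => j _; rewrite mul0r.
rewrite inE negb_or eq_sym => /andP[ur rs].
rewrite big_cons -(IH rs) /=.
under eq_bigr => j _ do rewrite natrD mulrDl.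
rewrite big_split /=; congr (_ + _).
have [j0 <-] := ch_codom ur.
rewrite (bigD1 j0) //= eqxx mul1r mxE big1 ?addr0 // => j jj0.
by rewrite (inj_eq ch_inj) eq_sym (negbTE jj0) mul0r.
Qed.

(** The climbs from the non-root vertices up to [r] form an integer left inverse: each telescopes to
    a unit vector, as [r] has no column. *)
Lemma normr_det_oriented_incidence : `|\det oriented_incidence| = 1.
Proof.
have [_ _ reach] := rootT.
have [l hl] : exists l : 'I_m -> nat, forall i,
    iter (l i) par (ch i) = r /\ r \notin traject par (ch i) (l i).
  have ex i : exists l, (iter l par (ch i) == r) && (r \notin traject par (ch i) l).
    by have [l [h1 h2]] := reach (ch i); exists l; rewrite h1 eqxx.
  exists (fun i => ex_minn (ex i)) => i.
  by case: ex_minnP => l /andP[/eqP].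
have inv : (\matrix_(i, j) vertical_row (ch i) (l i) j) *m oriented_incidence
    = 1%:M.
  apply/matrixP=> i k; have [h1 h2] := hl i; rewrite !mxE.
  under eq_bigr => j _ do rewrite [X in X * _]mxE.
  rewrite vertical_row_telescope // h1 (inj_eq ch_inj).
  by rewrite [r == _]eq_sym (negbTE (ch_nonroot k)) subr0.
have [_] := mulmx1_unit inv; rewrite unitmxE unfold_in /=.
by case/orP=> /eqP ->.
Qed.

Lemma normr_det_path_sums (A : 'M[int]_m) :
  (forall i, exists x y l1 l2, [/\ r \notin traject par x l1,
     r \notin traject par y l2
     & forall j, A i j = vertical_row x l1 j + vertical_row y l2 j]) ->
  `|\det A| <= 2 ^+ m.
Proof.
move=> hA.
(* The finite function type and the boolean test allow [xchoose] to select one [f] per row. *)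
have hAN i : exists f : {ffun bool -> option 'I_m * option 'I_m}, [forall k,
    (A *m oriented_incidence) i k ==
    \sum_b (((f b).1 == Some k)%:R - ((f b).2 == Some k)%:R)].
  (* Column of a vertex; the root goes to [None]. *)
  pose o v : option 'I_m := [pick j | ch j == v].
  have oE v k : (v == ch k) = (o v == Some k).
    rewrite /o; case: pickP => [j /eqP <-|none]; last by rewrite eq_sym none.
    by rewrite /eq_op /= -[RHS](inj_eq ch_inj).
  have [x [y [l1 [l2 [h1 h2 e]]]]] := hA i.
  exists [ffun b : bool => if b then (o x, o (iter l1 par x))
                           else (o y, o (iter l2 par y))].
  apply/forallP=> k; apply/eqP.
  rewrite big_bool !ffunE /= -!oE -!vertical_row_telescope // -big_split mxE.
  by apply: eq_bigr => j _; rewrite e mulrDl.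
pose f i := xchoose (hAN i).
pose F i b k : int := ((f i b).1 == Some k)%:R - ((f i b).2 == Some k)%:R.
have -> : `|\det A| = `|\det (A *m oriented_incidence)|.
  by rewrite det_mulmx normrM normr_det_oriented_incidence mulr1.
have -> : A *m oriented_incidence = \matrix_(i, k) \sum_b F i b k.
  by apply/matrixP=> i k; rewrite [RHS]mxE; apply/eqP; apply: (forallP (xchooseP (hAN i))).
rewrite det_row_sum; apply: le_trans (ler_norm_sum _ _ _) _.
have -> : 2 ^+ m = \sum_(g : {ffun 'I_m -> bool}) 1 :> int.
  by rewrite sumr_const card_ffun card_bool card_ord natrX.
apply: ler_sum => g _.
apply: (normr_det_row_differences (x := fun i => (f i (g i)).1)
                                  (y := fun i => (f i (g i)).2)) => i k.
by rewrite mxE.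
Qed.

End RootedTree.

(** * Rooting a tree by distance *)

Lemma tree_rooting (T : sgraph) :
  is_tree T -> exists (r : T) (par : T -> T), rooting r par.
Proof.
move=> treeT; have := tree_card_edges treeT.
case: treeT => -[/card_gt0P[r _] conn] _ cardE; exists r.
have dex v : exists l, [exists t : l.-tuple T,
    path (@adj T) r t && (last r t == v)].
  have /connectP[p pp ->] := conn r v.
  by exists (size p); apply/existsP; exists (in_tuple p); rewrite pp eqxx.
pose d v := ex_minn (dex v).
have parex v : v != r -> exists u, adj u v && (d u < d v)%N.
  move=> vr; rewrite {2}/d; case: ex_minnP => m /existsP[[t /= /eqP st]].
  case/andP=> pt /eqP lt _.
  case/lastP: t st pt lt => [|t w] st pt lt; first by rewrite -lt eqxx in vr.
  move: pt lt st; rewrite rcons_path last_rcons size_rcons => /andP[pt aw] wv <-.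
  exists (last r t); rewrite -wv aw /= ltnS /d; case: ex_minnP => l _; apply.
  by apply/existsP; exists (in_tuple t); rewrite pt eqxx.
(* A neighbour strictly nearer to [r]; the default occurs only at [v = r]. *)
pose par v := odflt r [pick u | adj u v && (d u < d v)%N].
have parP v : v != r -> adj (par v) v && (d (par v) < d v)%N.
  by move=> /parex[u hu]; rewrite /par; case: pickP => [//|/(_ u)]; rewrite hu.
exists par.
have finj : {in [set~ r] &, injective (parent_edge par)}.
  move=> v w; rewrite !inE => /parP/andP[_ dv] /parP/andP[_ dw] fe.
  have /setP ext := fe; have := ext v; have := ext w.
  rewrite !inE !eqxx !orbT => /orP[]/eqP wv /esym/orP[]/eqP vw //.
  (* Otherwise [v] and [w] would be parents of each other, each strictly nearer to [r]. *)
  by move: dv dw; rewrite -vw -wv; lia.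
split=> //.
  (* Both sets have [#|T|.-1] elements, so one inclusion suffices. *)
  apply/eqP; rewrite eqEcard card_in_imset // cardsC1 cardE leqnn andbT.
  apply/subsetP=> _ /imsetP[v + ->]; rewrite !inE => /parP/andP[a _].
  by apply/imsetP; exists (par v, v); rewrite ?inE.
move=> v; have [k] := ubnP (d v); elim: k v => // k IH v; rewrite ltnS => dk.
have [->|vr] := eqVneq v r; first by exists 0%N.
have /andP[_ dv] := parP v vr.
have [l [h1 h2]] := IH (par v) (leq_trans dv dk).
exists l.+1; rewrite iterSr h1; split=> //.
by rewrite trajectS inE negb_or eq_sym vr.
Qed.

(* The bound for path-edge incidence matrices *)
Local Close Scope ring_scope.

Theorem theorem12 (T : sgraph) (n : nat) (P : {set subgraph T})
    (hT : is_tree T) (hn : #|T| = n)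
    (hP : forall Q : subgraph T, Q \in P -> is_path Q) (hPn : #|P| = n.-1)
    (rows : n.-1.-tuple (subgraph T)) (cols : n.-1.-tuple {set T})
    (rows_uniq : uniq rows) (rowsP : rows =i P)
    (cols_uniq : uniq cols) (colsE : cols =i edges T) :
  (`|\det (path_edge_incidence rows cols)| <= 2 ^+ n.-1)%R.
Proof.
have [r [par rootT]] := tree_rooting hT; have [finj pE _] := rootT.
have chex j : exists v, (v != r) && (parent_edge par v == tnth cols j).
  have : tnth cols j \in edges T by rewrite -colsE mem_tnth.
  by rewrite -pE => /imsetP[v]; rewrite !inE => vr ->; exists v; rewrite vr eqxx.
(* Lower end of the edge in column [j]. *)
pose ch j := xchoose (chex j).
have ch_nonroot j : ch j != r by case/andP: (xchooseP (chex j)).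
have chE j : parent_edge par (ch j) = tnth cols j.
  by case/andP: (xchooseP (chex j)) => _ /eqP.
have ch_inj : injective ch.
  by move=> i j eij; apply: (tuple_uniqP _ cols_uniq); rewrite -!chE eij.
have ch_codom v : v != r -> exists j, ch j = v.
  move=> vr; have : parent_edge par v \in cols.
    by rewrite colsE -pE imset_f ?inE.
  by case/tnthP=> j ej; exists j; apply: finj; rewrite ?inE ?chE.
apply: (normr_det_path_sums rootT ch_inj ch_codom ch_nonroot) => i.
have [x [p [px up eQ]]] : is_path (tnth rows i) by apply: hP; rewrite -rowsP mem_tnth.
have [m1 [m2 [_ rs cnt]]] := path_two_vertical rootT px up.
move: rs; rewrite mem_cat negb_or => /andP[rs1 rs2].
(* The two vertical paths climb from the two ends of the path. *)
exists x, (last x p), m1, m2; split=> // j.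
by rewrite mxE eQ -chE -natrD -count_cat -cnt ?inE.
Qed.
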